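(* The expected number of steps in the Generalized Random Chemistry (GRC) algorithm, $$E[X]=\sum_{i=1}^M\frac{1}{p_i}=\sum_{i=1}^M\frac{\Gamma(n_{i-1}+1)\,\Gamma(n_i-k+1)}{\Gamma(n_i+1)\,\Gamma(n_{i-1}-k+1)},$$ is minimized over the real numbers for $p_i=\binom{n_0}{k}^{-1/M}$. The optimal value of $M$ is $\ln\binom{n_0}{k}$, in which case the expression for the $p_i$ reduces to $p_i=e^{-1}$ and $E[X]=e\ln\binom{n_0}{k}$.
   Context: Let $n_0\ge k\ge 0$ be integers, and let $S$ be an unknown $k$-element subset of $V_0=\{1,2,\dots,n_0\}$. Consider a sequence $n_0>n_1>n_2>\cdots>n_M=k$. The GRC algorithm works as follows. For $i=1,\dots,M$ in turn, given a set $V_{i-1}$ of size $n_{i-1}$ known to contain $S$, one repeatedly selects random subsets of $V_{i-1}$ of size $n_i$ until one containing $S$ is found; that subset is called $V_i$. The probability that a single selection at stage $i$ contains $S$ is $$p_i=\frac{\binom{n_{i-1}-k}{n_i-k}}{\binom{n_{i-1}}{n_i}}.$$ The number $X_i$ of selections needed at stage $i$ is a geometric random variable with mean $1/p_i$, and $X=X_1+\cdots+X_M$ is the total number of selections until $S$ is found. The original combinatorial problem is to choose $M\le n_0-k$ and integers $n_1,\dots,n_M$ subject to $n_0>n_1>\cdots>n_M=k$ so as to minimize $E[X]$. The theorem concerns the continuous analog, in which the $n_i$ are only required to be real and factorials are replaced by the Gamma function $\Gamma$ (with $\Gamma(m)=(m-1)!$ for positive integers $m$). Thus $p_i$ denotes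 $\frac{\Gamma(n_i+1)\,\Gamma(n_{i-1}-k+1)}{\Gamma(n_{i-1}+1)\,\Gamma(n_i-k+1)}$. Here $\ln$ is the natural logarithm. *)

(* Defs.v *)
From HB Require Import structures.
From mathcomp Require Import all_boot all_order all_algebra.
From mathcomp Require Import all_classical all_reals all_analysis.

Set Implicit Arguments.
Unset Strict Implicit.
Unset Printing Implicit Defensive.

Import Order.TTheory GRing.Theory Num.Theory.
Import numFieldNormedType.Exports.

Local Open Scope classical_set_scope.
Local Open Scope ring_scope.

(* Meaningful for x > 0 only: Rintegral sends the divergent integral to 0.
   All arguments used below are at least 1. *)
Definition Gamma {R : realType} (x : R) : R :=
  \int[lebesgue_measure]_(t in `]0, +oo[) (t `^ (x - 1) * expR (- t)).

(* The values of n beyond index M are irrelevant.  The case M = 0 is allowed;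
   it forces n0 = k. *)
Definition grc_chain {R : realType} (n0 k M : nat) (n : nat -> R) : Prop :=
  [/\ n 0%N = n0%:R, n M = k%:R & forall i, (i < M)%N -> n i.+1 < n i].

(* Stages are numbered from 1. *)
Definition grc_prob {R : realType} (k : nat) (n : nat -> R) (i : nat) : R :=
  (Gamma (n i + 1) * Gamma (n i.-1 - k%:R + 1)) /
  (Gamma (n i.-1 + 1) * Gamma (n i - k%:R + 1)).

Definition grc_mean {R : realType} (k M : nat) (n : nat -> R) : R :=
  \sum_(1 <= i < M.+1) (grc_prob k n i)^-1.

(* Number of independent trials, each successful with probability p, up to and
   including the first success: the law is supported on the positive integers
   (the masses below sum to 1 when 0 < p <= 1). *)
Definition geometric_rv {R : realType} d (T : measurableType d)
    (P : probability T R) (X : {RV P >-> R}) (p : R) : Prop :=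
  forall j : nat, P (X @^-1` [set j.+1%:R]) = (p * (1 - p) ^+ j)%:E.

(* The number M of stages is real here, so that it can be optimized over the
   reals. *)
Definition grc_opt_prob {R : realType} (n0 k : nat) (M : R) : R :=
  'C(n0, k)%:R `^ (- M^-1).

(* For a natural number M this is the sum of the M equal terms
   (grc_opt_prob n0 k M)^-1. *)
Definition grc_opt_mean {R : realType} (n0 k : nat) (M : R) : R :=
  M * (grc_opt_prob n0 k M)^-1.

(* Main.v *)
Require Import Defs.
From HB Require Import structures.
From mathcomp Require Import all_boot all_order all_algebra.
From mathcomp Require Import all_classical all_reals all_analysis.
From mathcomp Require Import measurable_realfun ring lra.

Set Implicit Arguments.
Unset Strict Implicit.
Unset Printing Implicit Defensive.

Import Order.TTheory GRing.Theory Num.Theory.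
Import numFieldNormedType.Exports.

Local Open Scope classical_set_scope.
Local Open Scope ring_scope.

(** As [k] is a natural number, the functional equation of [Gamma], applied [k]
    times, gives [Gamma (x + 1) / Gamma (x - k + 1) = f x] for [x >= k], where
    [f x = x (x - 1) ... (x - k + 1)] is the falling factorial.  So
    [p_i = f (n_i) / f (n_(i-1))], and the product of the [1 / p_i] telescopes
    to [f n0 / f k = 'C(n0, k)] for every chain ([grc_prod_prob]).  The sum of
    [M] positive numbers with a fixed product is least exactly when they are all
    equal: this is the arithmetic-geometric mean inequality with its equality
    case ([grc_mean_leif]).  The equalizing chain exists because [f] is
    continuous and strictly increasing on [[k, n0]] when [k > 0], so the
    intermediate value theorem yields [n_i] with
    [f (n_i) = f n0 * 'C(n0, k) `^ (- i / M)] ([grc_opt_chain]).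

    With [L = ln 'C(n0, k)] the minimum for [M] stages is [M * expR (L / M)].
    The tangent inequality [1 + x < expR x] at [x = L / M - 1 != 0] turns into
    [expR 1 * L < M * expR (L / M)] ([grc_opt_mean_gt]).

    The functional equation of [Gamma] ([GammaD1]) is an integration by parts on
    a half-line.  The expectation of a geometric variable
    ([integral_geometric]) is computed by splitting the space into the level
    sets of the variable, whose probabilities sum to 1; linearity of the
    integral then gives the mean of the total. *)

(** * The functional equation of the Gamma function *)

Section gamma.
Context {R : realType}.
Implicit Types a t x : R.
Notation mu := (@lebesgue_measure R).

Definition gamma_fun a t : R := t `^ a * expR (- t).

Lemma gamma_fun_ge0 a t : 0 <= gamma_fun a t.
Proof. by rewrite mulr_ge0 ?powR_ge0 ?expR_ge0. Qed.

(** All that is used about the growth of the integrand: it yields integrability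
    on the half-line and the limit 0 at infinity.  Writing [t = 2 a * u], it is
    [u `^ a <= expR u `^ a], that is, [u <= expR u]. *)
Lemma gamma_fun_le a t : 0 <= a -> 0 <= t ->
  gamma_fun a t <= (2 * a) `^ a * expR (- (t / 2)).
Proof.
move=> a0 t0.
have -> : expR (- (t / 2)) = expR (t / 2) * expR (- t).
  by rewrite -expRD; congr expR; field.
rewrite mulrA ler_wpM2r ?expR_ge0//.
(* The scaling by 2 a degenerates for a = 0, where both powers are 1. *)
have [->|an0] := eqVneq a 0.
  by rewrite !powRr0 mul1r -expR0 ler_expR divr_ge0.
have ta : t = (2 * a) * (t / (2 * a)) by field.
rewrite [in leLHS]ta powRM ?mulr_ge0 ?invr_ge0 ?mulr_ge0//.
rewrite ler_wpM2l ?powR_ge0//.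
have -> : expR (t / 2) = (expR (t / (2 * a))) `^ a.
  by rewrite -expRM; congr expR; field.
rewrite ge0_ler_powR ?nnegrE ?expR_ge0 ?mulr_ge0 ?invr_ge0 ?mulr_ge0//.
by rewrite (le_trans _ (expR_ge1Dx _))// lerDr.
Qed.

(** Continuity can only hold within the half-line: [powR] is 1 at negative
    bases. *)
Lemma continuous_powR_itvcy a : 0 <= a ->
  {within `[0, +oo[, continuous (fun t => t `^ a : R)}.
Proof.
move=> a0; apply/continuous_within_itvcyP; split.
  move=> t; rewrite in_itv/= andbT => t0.
  apply: differentiable_continuous; apply/derivable1_diffP.
  by apply: ex_derive; exact: is_derive1_powR.
have [->|an0] := eqVneq a 0.
  by under eq_fun do rewrite powRr0; rewrite powRr0; exact: cvg_cst.
by rewrite powR0//; apply: powR_cvg0; rewrite lt0r an0.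
Qed.

Lemma continuous_expRN : continuous (fun t => expR (- t) : R).
Proof.
move=> t; apply: (@continuous_comp _ _ _ -%R (@expR R)); last exact: continuous_expR.
exact: opp_continuous.
Qed.

Lemma continuous_gamma_fun a : 0 <= a ->
  {within `[0, +oo[, continuous (gamma_fun a)}.
Proof.
move=> a0 t.
apply: (@continuousM _ (subspace _) (fun t => t `^ a) (fun t => expR (- t))).
  exact: continuous_powR_itvcy.
exact: (continuous_subspaceT continuous_expRN).
Qed.

Lemma continuous_expR_half : continuous (fun t => expR (- (t / 2)) : R).
Proof.
move=> t; apply: differentiable_continuous; apply/derivable1_diffP; exact: ex_derive.
Qed.

Lemma cvg_expR_half : expR (- (t / 2)) @[t --> +oo] --> (0 : R).
Proof.
apply: (@cvg_comp _ _ _ (fun t : R => t / 2) (fun t => expR (- t)) _ +oo).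
  exact: gt0_cvgMly.
exact: cvgr_expR.
Qed.

Lemma is_derive_expR_half t :
  is_derive t 1 (fun t => expR (- (t / 2)) : R) (- 2^-1 * expR (- (t / 2))).
Proof.
apply: is_derive_eq.
by rewrite /GRing.scale/=; field.
Qed.
Lemma integral_expR_half :
  (\int[mu]_(t in `[0%R, +oo[) (expR (- (t / 2)))%:E = 2%:E)%E.
Proof.
rewrite (@ge0_continuous_FTC2y _ _ (fun t => - 2 * expR (- (t / 2))) _ 0)//.
- by rewrite mul0r oppr0 expR0 mulr1 -EFinB sub0r opprK.
- exact: continuous_subspaceT continuous_expR_half.
- by rewrite -[X in _ --> X](mulr0 (- 2)); apply: cvgMl_tmp; exact: cvg_expR_half.
- by apply: cvg_at_right_filter; apply: cvgMl_tmp; exact: continuous_expR_half.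
- move=> t _; rewrite derive1E deriveM// derive_cst scaler0 addr0.
  have [_ ->] := is_derive_expR_half t.
  by rewrite /GRing.scale/=; field.
Qed.

Lemma integrable_expR_half :
  mu.-integrable `[(0:R), +oo[ (fun t => (expR (- (t / 2)))%:E).
Proof.
apply/integrableP; split.
  apply/measurable_EFinP; apply: measurable_funTS.
  exact: continuous_measurable_fun continuous_expR_half.
under eq_integral do rewrite /= ger0_norm ?expR_ge0//.
by rewrite integral_expR_half ltry.
Qed.

Lemma integrable_gamma_fun a : 0 <= a ->
  mu.-integrable `[(0:R), +oo[ (EFin \o gamma_fun a).
Proof.
move=> a0.
have iK : mu.-integrable `[(0:R), +oo[
    (fun t => ((2 * a) `^ a)%:E * (expR (- (t / 2)))%:E)%E.
  by apply: integrableZl => //; exact: integrable_expR_half.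
apply: le_integrable iK => //.
- apply/measurable_EFinP; apply: subspace_continuous_measurable_fun => //.
  exact: continuous_gamma_fun.
- move=> t; rewrite /= in_itv/= andbT => t0; rewrite lee_fin.
  rewrite ger0_norm ?gamma_fun_ge0// (le_trans (gamma_fun_le a0 t0))//.
  exact: ler_norm.
Qed.

Lemma GammaE x : 1 <= x ->
  Gamma x = \int[mu]_(t in `[0, +oo[) gamma_fun (x - 1) t.
Proof.
move=> x1; rewrite -Rintegral_itv_obnd_cbnd//.
apply: integrableS (integrable_gamma_fun _) => //; last by rewrite subr_ge0.
by apply: subset_itvr; rewrite bnd_simp.
Qed.

(** The integrand is at least [expR (- 2)] on [[1, 2]]. *)
Lemma Gamma_gt0 x : 1 <= x -> 0 < Gamma x.
Proof.
move=> x1; have a0 : 0 <= x - 1 by rewrite subr_ge0.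
rewrite GammaE//.
have fin := integrable_fin_num _ (integrable_gamma_fun a0).
rewrite /Rintegral -lte_fin fineK; last exact: fin.
apply: (@lt_le_trans _ _ (\int[mu]_(t in `[1%R, 2%R]) cst (expR (- 2))%:E t)%E).
  rewrite integral_cst//= lebesgue_measure_itv/= lte_fin ltr1n -EFinB -EFinM.
  by rewrite lte_fin mulr_gt0 ?expR_gt0// subr_gt0 ltr1n.
have mf : measurable_fun `[(0:R), +oo[ (EFin \o gamma_fun (x - 1)).
  exact: measurable_int (integrable_gamma_fun a0).
have sub : `[1%R, 2%R] `<=` `[(0:R), +oo[.
  by move=> t /=; rewrite !in_itv/= andbT => /andP[t1 _]; rewrite (le_trans _ t1).
apply: (@le_trans _ _ (\int[mu]_(t in `[1%R, 2%R]) (gamma_fun (x - 1) t)%:E)%E).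
  apply: ge0_le_integral => //.
  - by move=> t _; rewrite lee_fin expR_ge0.
  - exact: measurable_funS mf.
  - move=> t; rewrite /= in_itv/= => /andP[t1 t2]; rewrite lee_fin.
    rewrite -[leLHS]mul1r ler_pM ?expR_ge0 ?ler_expR ?lerN2//.
    by rewrite -[leLHS](powRr0 t) ler_powR.
apply: ge0_subset_integral => //.
by move=> t _; rewrite lee_fin gamma_fun_ge0.
Qed.

Lemma cvg_gamma_fun a : 0 <= a -> gamma_fun a t @[t --> +oo] --> 0.
Proof.
move=> a0; apply: (@squeeze_cvgr _ _ _ _ (cst 0)
  (fun t => (2 * a) `^ a * expR (- (t / 2)))); last 2 first.
- exact: cvg_cst.
- rewrite -[X in _ --> X](mulr0 ((2 * a) `^ a)); apply: cvgMl_tmp.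
  exact: cvg_expR_half.
near=> t; rewrite gamma_fun_ge0 gamma_fun_le//.
Unshelve. all: by end_near. Qed.

Lemma is_derive_gamma_fun a t : 0 < t ->
  is_derive t 1 (gamma_fun a) (a * gamma_fun (a - 1) t - gamma_fun a t).
Proof.
move=> t0; have dp := is_derive1_powR a t0.
have dN : is_derive t 1 (-%R : R -> R) (- 1) by exact: is_deriveNid.
have de := @is_derive1_comp _ (@expR R) -%R t _ _ (is_derive_expR (- t)) dN.
apply: (is_derive_eq (is_deriveM dp de)).
by rewrite /GRing.scale/= /gamma_fun; ring.
Qed.

(** The derivative [d] of [t `^ x * expR (- t)], a function that vanishes at 0
    and at infinity, has integral [x * Gamma x - Gamma (x + 1)].  The fundamental
    theorem of calculus [ge0_continuous_FTC2y] asks for a nonnegative integrand,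
    and [d] changes sign; it is therefore applied to [d + K * e], with
    [e t = expR (- (t / 2))] and [K] large enough, and the integral [K * 2] of
    the correction is subtracted. *)
Lemma GammaD1 x : 1 <= x -> Gamma (x + 1) = x * Gamma x.
Proof.
move=> x1; have a0 : 0 <= x - 1 by rewrite subr_ge0.
have x0 : 0 <= x by rewrite (le_trans _ x1).
rewrite !GammaE ?addrK; [|by rewrite ?lerDr..].
set I := \int[mu]_(t in _) _; set J := \int[mu]_(t in _) _.
(* K is the sum of the bounds of gamma_fun_le for the two terms of d. *)
pose K := x * (2 * (x - 1)) `^ (x - 1) + (2 * x) `^ x.
pose e t : R := expR (- (t / 2)).
pose d t : R := x * gamma_fun (x - 1) t - gamma_fun x t.
have ix := integrable_gamma_fun x0.
have ia := integrable_gamma_fun a0.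
have ie := integrable_expR_half.
have iZ c f : mu.-integrable `[(0:R), +oo[ (EFin \o f) ->
    mu.-integrable `[(0:R), +oo[ (EFin \o (fun t => c * f t)).
  move=> h; have h' : mu.-integrable `[(0:R), +oo[
      (fun t => c%:E * (EFin \o f) t)%E by exact: integrableZl.
  exact: h'.
have ixa : mu.-integrable `[(0:R), +oo[ (EFin \o (fun t => x * gamma_fun (x - 1) t)).
  exact: iZ.
have iKe : mu.-integrable `[(0:R), +oo[ (EFin \o (fun t => K * e t)).
  exact: iZ.
have id : mu.-integrable `[(0:R), +oo[ (EFin \o d).
  have h : mu.-integrable `[(0:R), +oo[ ((EFin \o (fun t => x * gamma_fun (x - 1) t)%R)
      \- (EFin \o gamma_fun x))%E by exact: integrableB.
  exact: h.
have E0 : \int[mu]_(t in `[0, +oo[) e t = 2.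
  by rewrite /Rintegral integral_expR_half.
have E1 : \int[mu]_(t in `[0, +oo[) (d t + K * e t) = x * J - I + K * 2.
  rewrite RintegralD// RintegralB// !RintegralZl//.
  by rewrite E0.
have E2 : \int[mu]_(t in `[0, +oo[) (d t + K * e t) = K * 2.
  rewrite (@Rintegral_ge0_continuous_FTC2y _ _
    (fun t => gamma_fun x t - 2 * K * e t) _ 0)//.
  - rewrite /gamma_fun powR0 ?gt_eqF// ?(lt_le_trans _ x1)// /e !mul0r oppr0 expR0.
    ring.
  - move=> t t0; rewrite /d /K mulrDl.
    have := gamma_fun_le a0 t0; have := gamma_fun_le x0 t0; rewrite -/(e t) => h1 h2.
    have h3 : 0 <= x * gamma_fun (x - 1) t by rewrite mulr_ge0 ?gamma_fun_ge0.
    have h4 : 0 <= x * (2 * (x - 1)) `^ (x - 1) * e t.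
      by rewrite !mulr_ge0 ?powR_ge0 ?expR_ge0.
    lra.
  - move=> t; apply: (@continuousD _ _ (subspace _) d (fun t => K * e t)).
      apply: (@continuousB _ _ (subspace _) (fun t => x * gamma_fun (x - 1) t) (gamma_fun x)).
        by apply: cvgMl_tmp; exact: continuous_gamma_fun.
      exact: continuous_gamma_fun.
    by apply: cvgMl_tmp; exact: (continuous_subspaceT continuous_expR_half).
  - rewrite -[X in _ --> X]subr0 -[X in _ - X](mulr0 (2 * K)).
    apply: cvgB; first exact: cvg_gamma_fun.
    by apply: cvgMl_tmp; exact: cvg_expR_half.
  - move=> t t0; apply: derivableB.
      by have [] := is_derive_gamma_fun x t0.
    by apply: derivableM => //; have [] := is_derive_expR_half t.
  - apply: cvgB.
      by have /continuous_within_itvcyP[] := continuous_gamma_fun x0.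
    apply: cvgMl_tmp; apply: cvg_at_right_filter; exact: continuous_expR_half.
  - move=> t; rewrite in_itv/= andbT => t0.
    have dg := is_derive_gamma_fun x t0; have de := is_derive_expR_half t.
    rewrite derive1E; apply: derive_val.
    apply: (@is_derive_eq _ _ _ _ _ _ _ _ (is_deriveB dg (is_deriveZ (2 * K) de))).
    by rewrite /d /GRing.scale/= /e; field.
by apply/eqP; rewrite eq_sym -subr_eq0 -[_ - _](addrK (K * 2)) -E1 E2 subrr.
Qed.
End gamma.

(** * Falling factorials of a real number *)

Section falling.
Context {R : realType}.
Implicit Types (k : nat) (x y : R).

Definition falling k x : R := \prod_(j < k) (x - j%:R).

Lemma falling_gt0 k x : k%:R <= x -> 0 < falling k x.
Proof.
move=> kx; apply: prodr_gt0 => j _.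
by rewrite subr_gt0 (lt_le_trans _ kx)// ltr_nat.
Qed.

Lemma falling_lt k x y : (0 < k)%N -> k%:R <= x -> x < y ->
  falling k x < falling k y.
Proof.
case: k => // k _ kx xy; rewrite /falling !big_ord_recr/=.
have kx' : k%:R < x by rewrite (lt_le_trans _ kx)// ltr_nat.
apply: (@le_lt_trans _ _ (falling k y * (x - k%:R))).
  rewrite ler_wpM2r ?subr_ge0 ?(ltW kx')//; apply: ler_prod => j _.
  rewrite subr_ge0 lerD2r (ltW xy) andbT (le_trans _ (ltW kx'))//.
  by rewrite ler_nat ltnW.
by rewrite ltr_pM2l ?ltrD2r// falling_gt0// ltW// (lt_trans kx').
Qed.

Lemma falling_le k x y : k%:R <= x -> x <= y -> falling k x <= falling k y.
Proof.
case: k => [|k] kx; first by rewrite /falling !big_ord0.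
by rewrite le_eqVlt => /predU1P[->//|xy]; rewrite ltW// falling_lt.
Qed.

Lemma continuous_falling k : continuous (falling k).
Proof.
elim: k => [|k ih] x.
  rewrite (_ : falling 0 = cst 1); first exact: cst_continuous.
  by apply/funext => y; rewrite /falling big_ord0.
rewrite (_ : falling k.+1 = (fun y => falling k y * (y - k%:R))); last first.
  by apply/funext => y; rewrite /falling big_ord_recr.
apply: (@cvgM _ _ _ _ (falling k) (fun y => y - k%:R)); first exact: ih.
by apply: cvgB => //; exact: cvg_cst.
Qed.

Lemma falling_bin n k : (k <= n)%N ->
  falling k n%:R = 'C(n, k)%:R * falling k k%:R.
Proof.
have fallingE m : (k <= m)%N -> falling k m%:R = (m ^_ k)%:R.
  move=> km; rewrite ffact_prod natr_prod; apply: eq_bigr => j _.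
  by rewrite natrB// (leq_trans (ltnW (ltn_ord j))).
by move=> kn; rewrite !fallingE// ffactnn -natrM bin_ffact.
Qed.

(** The hypothesis keeps every argument of [Gamma] in the induction at least 1,
    where [GammaD1] holds. *)
Lemma Gamma_falling k x : k%:R <= x ->
  Gamma (x + 1) = falling k x * Gamma (x - k%:R + 1).
Proof.
elim: k => [|k ih] kx; first by rewrite /falling big_ord0 mul1r subr0.
have kx1 : 1 <= x - k%:R by rewrite lerBrDr -natr1 addrC in kx *.
rewrite ih; last by rewrite (le_trans _ kx)// ler_nat.
rewrite GammaD1// mulrA /falling big_ord_recr/=; congr (_ * Gamma _).
by rewrite -natr1; ring.
Qed.

End falling.

(** * Chains and the minimum for a fixed number of stages *)

Section chain.
Context {R : realType}.
Variables (n0 k : nat) (hk : (k <= n0)%N).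
Implicit Types (M : nat) (n : nat -> R).

Let bin_gt0r : 0 < 'C(n0, k)%:R :> R.
Proof. by rewrite ltr0n bin_gt0. Qed.

Lemma grc_probE n i : k%:R <= n i -> k%:R <= n i.+1 ->
  grc_prob k n i.+1 = falling k (n i.+1) / falling k (n i).
Proof.
move=> ki kj; rewrite /grc_prob/= (Gamma_falling ki) (Gamma_falling kj).
have Gi : Gamma (n i - k%:R + 1) != 0 by rewrite gt_eqF// Gamma_gt0// lerDr subr_ge0.
have Gj : Gamma (n i.+1 - k%:R + 1) != 0.
  by rewrite gt_eqF// Gamma_gt0// lerDr subr_ge0.
have fi : falling k (n i) != 0 by rewrite gt_eqF// falling_gt0.
by field; rewrite fi Gi Gj.
Qed.

Lemma grc_chain_ge M n i : grc_chain n0 k M n -> (i <= M)%N -> k%:R <= n i.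
Proof.
move=> [_ nM dec] iM.
suff : forall j, (j <= M)%N -> k%:R <= n (M - j)%N.
  by move=> /(_ (M - i)%N); rewrite subKn//; apply; exact: leq_subr.
elim=> [|j ih] jM; first by rewrite subn0 nM.
apply: (le_trans (ih (ltnW jM))); apply: ltW.
by rewrite -[(M - j)%N]prednK ?subn_gt0// -subnS dec// ltn_subrL (leq_ltn_trans _ jM).
Qed.

Lemma grc_prob_chainE M n i : grc_chain n0 k M n -> (i < M)%N ->
  grc_prob k n i.+1 = falling k (n i.+1) / falling k (n i).
Proof.
by move=> ch iM; apply: grc_probE; apply: (grc_chain_ge ch) => //; exact: ltnW.
Qed.

Lemma grc_prob_itv M n i : grc_chain n0 k M n -> (i < M)%N ->
  0 < grc_prob k n i.+1 <= 1.
Proof.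
move=> ch iM; rewrite (grc_prob_chainE ch iM).
have ki := grc_chain_ge ch (ltnW iM); have kj := grc_chain_ge ch iM.
rewrite divr_gt0 ?falling_gt0//= ler_pdivrMr ?falling_gt0// mul1r.
by apply: falling_le => //; apply: ltW; have [_ _] := ch; apply.
Qed.

(** The quotients of falling factorials telescope: the product does not depend
    on the chain, only on its ends. *)
Lemma grc_prod_prob M n : grc_chain n0 k M n ->
  \prod_(i < M) (grc_prob k n i.+1)^-1 = 'C(n0, k)%:R.
Proof.
move=> ch.
have fk : falling k (k%:R : R) != 0 by rewrite gt_eqF// falling_gt0.
suff h j : (j <= M)%N -> \prod_(i < j) (grc_prob k n i.+1)^-1 =
    falling k n0%:R / falling k (n j).
  by rewrite h//; have [_ -> _] := ch; rewrite falling_bin// mulfK.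
elim: j => [|j ih] jM.
  rewrite big_ord0; have [-> _ _] := ch.
  by rewrite divff// gt_eqF// falling_gt0// ler_nat.
rewrite big_ord_recr/= ih ?(ltnW jM)// (grc_prob_chainE ch)// invf_div.
by rewrite mulrA mulfVK// gt_eqF// falling_gt0// (grc_chain_ge ch)// ltnW.
Qed.

Lemma grc_meanE M n : grc_mean k M n = \sum_(i < M) (grc_prob k n i.+1)^-1.
Proof. by rewrite /grc_mean big_add1 big_mkord. Qed.

Lemma grc_opt_probXn M : (0 < M)%N ->
  (grc_opt_prob n0 k M%:R)^-1 ^+ M = 'C(n0, k)%:R :> R.
Proof.
move=> M0; rewrite /grc_opt_prob powRN invrK -powR_mulrn ?powR_ge0// -powRrM.
by rewrite mulVf ?pnatr_eq0 -?lt0n// powRr1// ltW.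
Qed.

Lemma grc_opt_prob_gt0 (x : R) : 0 < grc_opt_prob n0 k x.
Proof. exact: powR_gt0. Qed.

(** The arithmetic-geometric mean inequality for the [1 / p_i], whose product is
    known.  Its equality case says that the [p_i] are equal to one another; their
    common value is then forced by the product. *)
Lemma grc_mean_leif M n : grc_chain n0 k M n ->
  grc_opt_mean n0 k M%:R <= grc_mean k M n
    ?= iff [forall i : 'I_M, grc_prob k n i.+1 == grc_opt_prob n0 k M%:R].
Proof.
move=> ch; rewrite grc_meanE /grc_opt_mean.
have := grc_opt_prob_gt0 M%:R; set q := grc_opt_prob _ _ _ => q0.
have sum_opt : (forall i : 'I_M, grc_prob k n i.+1 = q) ->
    \sum_(i < M) (grc_prob k n i.+1)^-1 = M%:R * q^-1.
  move=> h; under eq_bigr do rewrite h.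
  by rewrite sumr_const card_ord mulr_natl.
have [M0|M0] := posnP M.
  subst M; rewrite big_ord0 mul0r; split=> //; rewrite eqxx; apply/esym/forallP.
  by case.
have qM : q^-1 ^+ M = 'C(n0, k)%:R by exact: grc_opt_probXn.
have M0r : 0 < M%:R :> R by rewrite ltr0n.
have E0 (i : 'I_M) : 0 < (grc_prob k n i.+1)^-1.
  by rewrite invr_gt0; have /andP[] := grc_prob_itv ch (ltn_ord i).
have qV0 : 0 < q^-1 by rewrite invr_gt0.
have := @leif_AGM R 'I_M predT (fun i => (grc_prob k n i.+1)^-1) (fun i _ => ltW (E0 i)).
rewrite /= (grc_prod_prob ch) card_ord -qM; set S := \sum_(i < M) _ => -[le eq].
have S0 : 0 <= S by apply: sumr_ge0 => i _; exact: ltW.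
split.
  move: le; rewrite ler_pXn2r ?nnegrE ?divr_ge0 ?(ltW qV0)//.
  by rewrite ler_pdivlMr// mulrC.
apply/eqP/forallP => [Sq i|h]; last by rewrite /S sum_opt// => i; exact/eqP.
have : q^-1 ^+ M == (S / M%:R) ^+ M by rewrite -Sq mulrAC divff ?mul1r// gt_eqF.
rewrite eq => /forallP h; rewrite -(inj_eq invr_inj).
rewrite -(@eqrXn2 _ M)// ?ltW// qM -(grc_prod_prob ch).
rewrite (eq_bigr (fun _ => (grc_prob k n i.+1)^-1)).
  by rewrite prodr_const card_ord.
by move=> j _; have /implyP/(_ isT)/forallP/(_ i)/implyP/(_ isT)/eqP := h j.
Qed.

(** The product of the first [i] optimal probabilities prescribes the value
    [v i] of the falling factorial at [n i]. *)
Lemma grc_opt_chain M : (0 < M)%N = (k < n0)%N ->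
  exists2 n : nat -> R, grc_chain n0 k M n &
    forall i, (1 <= i <= M)%N -> grc_prob k n i = grc_opt_prob n0 k M%:R.
Proof.
have [M0|M0] := posnP M => /esym.
  move=> /negbT; rewrite -leqNgt M0 => n0k.
  exists (fun _ => k%:R); last by move=> i; rewrite leqn0 => /andP[/lt0n_neq0/negbTE->].
  by split=> //; congr _%:R; apply/eqP; rewrite eqn_leq hk n0k.
move=> kn0; have M0r : 0 < M%:R :> R by rewrite ltr0n.
(* For k = 0 the falling factorial is constantly 1 and cannot determine the
   chain, but then every p_i is 1: equally spaced points will do. *)
have [k0|k0] := posnP k.
  exists (fun i => n0%:R * (1 - i%:R / M%:R)).
    split; first by rewrite mul0r subr0 mulr1.
      by rewrite divff ?gt_eqF// subrr mulr0 k0.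
    move=> i _; rewrite ltr_pM2l ?ltr0n ?(leq_ltn_trans _ kn0)//.
    by rewrite ltrD2l ltrN2 ltr_pM2r ?invr_gt0// ltr_nat.
  case=> // i /andP[_ iM]; rewrite grc_probE ?k0 /falling ?big_ord0.
  + by rewrite divr1 /grc_opt_prob bin0 powR1.
  + rewrite mulr_ge0// subr_ge0 ler_pdivrMr// mul1r ler_nat; exact: ltnW.
  + by rewrite mulr_ge0// subr_ge0 ler_pdivrMr// mul1r ler_nat.
have C1 : 1 < 'C(n0, k)%:R :> R.
  rewrite ltr1n (leq_trans _ (leq_bin2l k kn0))//.
  by rewrite binSn ltnS.
pose C : R := 'C(n0, k)%:R.
have C0 : C != 0 by rewrite gt_eqF.
pose v i : R := falling k n0%:R * C `^ (- (i%:R / M%:R)).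
have fk0 : 0 < falling k (k%:R : R) by rewrite falling_gt0.
have v_lt i : v i.+1 < v i.
  rewrite /v ltr_pM2l ?falling_gt0 ?ler_nat//.
  rewrite /powR (negbTE C0) ltr_expR ltr_pM2r ?ln_gt0// ltrN2.
  by rewrite ltr_pM2r ?invr_gt0// ltr_nat.
have vM : v M = falling k k%:R.
  rewrite /v divff ?gt_eqF// powR_inv1 ?(ltW bin_gt0r)// falling_bin//.
  by rewrite mulrAC divff// mul1r.
have v0 : v 0%N = falling k n0%:R by rewrite /v mul0r oppr0 powRr0 mulr1.
have v_le i j : (i <= j)%N -> v j <= v i.
  by apply: (@homo_leq _ v (fun x y => y <= x)) => //;
    [move=> x y z xy yz; exact: le_trans yz xy|move=> m; exact: ltW].
(* Indices beyond M are not covered by the intermediate value theorem; the guard leaves the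
   chain arbitrary there. *)
have ex i : exists x : R, (i <= M)%N ->
    (k%:R <= x <= n0%:R) /\ falling k x = v i.
  have [iM|] := leqP i M; last by exists 0.
  have kn0r : k%:R <= n0%:R :> R by rewrite ler_nat.
  have [||x] := @IVT R (falling k) k%:R n0%:R (v i) kn0r.
  - exact: continuous_subspaceT (@continuous_falling R k).
  - have h1 : falling k (k%:R : R) <= falling k n0%:R by exact: falling_le.
    by rewrite (min_idPl h1) (max_idPr h1) -vM -v0 !v_le.
  by rewrite in_itv/= => kxn fx; exists x.
have [n nP] := choice ex.
have inj (x y : R) : k%:R <= x -> k%:R <= y -> falling k x = falling k y -> x = y.
  move=> kx ky fxy; have [xy|xy|//] := ltgtP x y.
    by have := falling_lt k0 kx xy; rewrite fxy ltxx.
  by have := falling_lt k0 ky xy; rewrite fxy ltxx.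
have kn i : (i <= M)%N -> k%:R <= n i by move=> /nP[/andP[]].
exists n.
  split.
  - by apply: inj; rewrite ?kn ?ler_nat//; have [_ ->] := nP 0%N isT.
  - by apply: inj; rewrite ?kn//; have [_ ->] := nP M (leqnn M).
  - move=> i iM; rewrite ltNge; apply/negP => /(falling_le (kn _ (ltnW iM))).
    have [_ ->] := nP _ iM; have [_ ->] := nP _ (ltnW iM).
    by rewrite leNgt v_lt.
case=> // i /andP[_ iM]; rewrite grc_probE ?kn ?(ltnW iM)//.
have [_ ->] := nP _ iM; have [_ ->] := nP _ (ltnW iM).
rewrite /v -mulf_div divff ?mul1r ?gt_eqF ?falling_gt0 ?ler_nat//.
rewrite -powRB ?C0 ?implybT// /grc_opt_prob; congr (_ `^ _).
by rewrite -natr1; field; rewrite gt_eqF.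
Qed.

End chain.

(** * Expectation of a sum of geometric variables *)

Section geometric.
Context {R : realType}.
Implicit Types (p : R).

Lemma eseries_EFin (u : nat -> R) (l : R) :
  series u @ \oo --> l -> (\sum_(0 <= j <oo) (u j)%:E = l%:E)%E.
Proof.
move=> ul.
rewrite (_ : (fun n => _) = EFin \o series u); last first.
  by apply/funext => n /=; rewrite sumEFin.
by rewrite EFin_lim; [rewrite (cvg_lim _ ul)|exact: cvgP ul].
Qed.

Lemma cvg_geometric_mass p : 0 < p <= 1 ->
  series (fun j => p * (1 - p) ^+ j) @ \oo --> (1 : R).
Proof.
move=> /andP[p0 p1].
have := @cvg_geometric_series R p (1 - p).
rewrite subKr divff ?gt_eqF//; apply.
by rewrite ger0_norm ?subr_ge0// ltrBlDr ltrDl.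
Qed.

(** The partial sums [S n] are nondecreasing and bounded by [p^-1], hence
    converge; passing to the limit in [S n.+1 = q * S n + (1 - q ^+ n.+1)] gives
    [s = q * s + 1], where [q = 1 - p].  This avoids the limit of
    [n%:R * q ^+ n]. *)
Lemma cvg_geometric_mean p : 0 < p <= 1 ->
  series (fun j => j.+1%:R * (p * (1 - p) ^+ j)) @ \oo --> p^-1.
Proof.
move=> p01; have /andP[p0 p1] := p01; set q := 1 - p.
have q0 : 0 <= q by rewrite subr_ge0.
set S := series _.
have SE n : S n = p^-1 - (p^-1 + n%:R) * q ^+ n.
  elim: n => [|n ih]; first by rewrite /S seriesEnat/= big_nil; field; rewrite gt_eqF.
  rewrite /S seriesEnat/= big_nat_recr//= -[X in X + _]/(S n) ih exprS -natr1 /q.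
  by field; rewrite gt_eqF.
have cS : cvgn S.
  apply: nondecreasing_is_cvgn.
    apply: nondecreasing_series => n _ _.
    by rewrite !mulr_ge0// ?(ltW p0) ?exprn_ge0.
  exists p^-1 => _ [n _ <-]; rewrite SE gerBl.
  by rewrite mulr_ge0 ?exprn_ge0// addr_ge0// invr_ge0 ltW.
suff -> : p^-1 = limn S by [].
have rec n : S n.+1 = q * S n + series (fun j => p * q ^+ j) n.+1.
  elim: n => [|n ih].
    by rewrite /S !seriesEnat/= !big_nat1 big_nil mulr0 add0r mul1r.
  rewrite /S !seriesEnat/= big_nat_recr//= [in X in _ = _ + X]big_nat_recr//=.
  rewrite -[X in X + _ = _]/(S n.+1) ih seriesEnat/=.
  rewrite [in X in _ = q * X + _]big_nat_recr//= -[X in _ = q * (X + _) + _]/(S n).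
  by rewrite exprS -[n.+2%:R]natr1; ring.
have lim1 : S n.+1 @[n --> \oo] --> limn S by rewrite (cvg_shiftS S).
have lim2 : S n.+1 @[n --> \oo] --> q * limn S + 1.
  under eq_fun do rewrite rec.
  apply: cvgD; first exact: cvgMl_tmp.
  rewrite (cvg_shiftS (series (fun j => p * q ^+ j))).
  exact: cvg_geometric_mass.
have e : limn S = q * limn S + 1.
  exact: cvg_unique lim1 lim2.
apply: (mulfI (lt0r_neq0 p0)); rewrite divff ?gt_eqF//.
by move: e; rewrite /q; set s := limn S; lra.
Qed.

Context d (T : measurableType d) (P : probability T R).

(** The function [f] agrees with [X] on the level sets [X = j.+1], which have
    total probability 1.  It is kept apart from [X] so that the statement applies
    both to [X], for the expectation, and to [`|X|], for integrability: the
    law leaves [X] free, possibly negative, on a null set. *)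
Lemma integral_geometric p (X : {RV P >-> R}) (f : T -> R) :
  0 < p <= 1 -> geometric_rv X p -> measurable_fun setT f ->
  (forall w j, X w = j.+1%:R -> f w = j.+1%:R) ->
  (\int[P]_w (f w)%:E = (p^-1)%:E)%E.
Proof.
move=> p01 gX mf fX.
pose A j := X @^-1` [set j.+1%:R].
have mA j : measurable (A j).
  by rewrite -[A j]setTI; exact: measurable_funP.
have tA : trivIset setT A.
  apply/trivIsetP => i j _ _ ij; apply/seteqP; split=> // w [/= Xi Xj].
  have /eqP : i.+1%:R = j.+1%:R :> R by rewrite -Xi -Xj.
  by rewrite eqr_nat eqSS (negbTE ij).
pose D := \bigcup_j A j.
have mD : measurable D by exact: bigcup_measurable.
have PD : P D = 1%E.
  rewrite measure_semi_bigcup// -(eseries_EFin (cvg_geometric_mass p01)).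
  by apply: eq_eseriesr => j _; exact: gX.
have nD : P (~` D) = 0%E by rewrite probability_setC// PD subee.
have fA j w : A j w -> f w = j.+1%:R by exact: fX.
have mEf : measurable_fun setT (EFin \o f) by exact/measurable_EFinP.
rewrite (@ae_eq_integral _ _ _ P setT ((EFin \o f) \_ D) (EFin \o f))//; last 2 first.
- by apply/measurable_restrict => //; exact: measurable_funS mEf.
- exists (~` D); split; first exact: measurableC.
    exact: nD.
  move=> w; apply: contra_not => Dw _; rewrite patchE mem_set//.
rewrite -integral_mkcond ge0_integral_bigcup//; last 2 first.
- exact: measurable_funS mEf.
- by move=> w [j _ /fA]/= ->; rewrite lee_fin.
rewrite -(eseries_EFin (cvg_geometric_mean p01)).
apply: eq_eseriesr => j _.
rewrite (eq_integral (cst j.+1%:R%:E)); last first.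
  by move=> w /[!inE] /fA /= ->.
by rewrite integral_cst// EFinM; congr (_ * _)%E; exact: gX.
Qed.

Lemma expectation_sum_geometric M (p : nat -> R) (X : nat -> {RV P >-> R}) :
  (forall i, (1 <= i <= M)%N -> 0 < p i <= 1) ->
  (forall i, (1 <= i <= M)%N -> geometric_rv (X i) (p i)) ->
  ('E_P[fun w => (\sum_(1 <= i < M.+1) X i w)%R] =
    (\sum_(1 <= i < M.+1) (p i)^-1)%:E)%E.
Proof.
move=> p01 gX; rewrite unlock.
under eq_integral do rewrite big_add1 big_mkord -sumEFin.
rewrite big_add1 big_mkord -sumEFin.
rewrite integral_sum//; last first.
  move=> i; have iM : (1 <= i.+1 <= M)%N by rewrite /=.
  apply/integrableP; split; first exact/measurable_EFinP.
  rewrite (_ : (\int[P]_x _)%E = ((p i.+1)^-1)%:E) ?ltry//.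
  apply: (integral_geometric (p01 _ iM) (gX _ iM)) => /=.
    by apply: measurableT_comp => //.
  by move=> w j ->; rewrite ger0_norm.
apply: eq_bigr => i _; have iM : (1 <= i.+1 <= M)%N by rewrite /=.
exact: (integral_geometric (p01 _ iM) (gX _ iM)).
Qed.

End geometric.

(** * The optimal real number of stages *)

Section optimal_stages.
Context {R : realType}.
Variables (n0 k : nat) (hk : (k <= n0)%N).
Let L : R := ln 'C(n0, k)%:R.

Lemma grc_opt_probE (M : R) : grc_opt_prob n0 k M = expR (- (L / M)).
Proof.
rewrite /grc_opt_prob /powR gt_eqF ?ltr0n ?bin_gt0//.
by rewrite mulNr mulrC.
Qed.

Lemma grc_opt_meanE (M : R) : grc_opt_mean n0 k M = M * expR (L / M).
Proof. by rewrite /grc_opt_mean grc_opt_probE expRN invrK. Qed.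

Lemma grc_opt_mean_gt (M : R) : 0 < M -> M != L ->
  expR 1 * L < grc_opt_mean n0 k M.
Proof.
move=> M0 ML; rewrite grc_opt_meanE.
have x0 : L / M - 1 != 0.
  apply: contra ML => /eqP h; apply/eqP.
  have : L / M = 1 by lra.
  by move=> /(congr1 ( *%R^~ M)); rewrite mul1r mulfVK ?gt_eqF.
have := expR_gt1Dx x0; rewrite addrC subrK expRB.
rewrite ltr_pdivlMr ?expR_gt0// -(ltr_pM2l M0).
suff -> : M * (L / M * expR 1) = expR 1 * L by [].
by field; rewrite gt_eqF.
Qed.
End optimal_stages.

Theorem theorem2 (R : realType) (n0 k : nat) (hk : (k <= n0)%N) :
  [/\ (* the expected number of selections *)
      (forall (M : nat) (n : nat -> R), grc_chain n0 k M n ->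
        (forall (d : measure_display) (T : measurableType d)
            (P : probability T R) (X : nat -> {RV P >-> R}),
          (forall i, (1 <= i <= M)%N -> geometric_rv (X i) (grc_prob k n i)) ->
          ('E_P[fun w => (\sum_(1 <= i < M.+1) X i w)%R] = (grc_mean k M n)%:E)%E) /\
        grc_mean k M n =
          \sum_(1 <= i < M.+1)
            (Gamma (n i.-1 + 1) * Gamma (n i - k%:R + 1)) /
            (Gamma (n i + 1) * Gamma (n i.-1 - k%:R + 1))),
      (* for fixed M, the real n_i equalizing the p_i exist, and they are
         exactly the minimizers *)
      (forall M : nat, (0 < M)%N = (k < n0)%N ->
        exists2 n : nat -> R, grc_chain n0 k M n &
          forall i, (1 <= i <= M)%N ->
            grc_prob k n i = grc_opt_prob n0 k M%:R),
      (forall (M : nat) (n : nat -> R), grc_chain n0 k M n ->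
        (forall n' : nat -> R, grc_chain n0 k M n' ->
          grc_mean k M n <= grc_mean k M n') <->
        (forall i, (1 <= i <= M)%N ->
          grc_prob k n i = grc_opt_prob n0 k M%:R)),
      (forall (M : nat) (n : nat -> R), grc_chain n0 k M n ->
        (forall i, (1 <= i <= M)%N ->
          grc_prob k n i = grc_opt_prob n0 k M%:R) ->
        grc_mean k M n = grc_opt_mean n0 k M%:R) &
      (* the optimal M, over the positive reals *)
      let L : R := ln 'C(n0, k)%:R in
      ((0 < k < n0)%N ->
        [/\ 0 < L,
            forall M : R, 0 < M -> M != L ->
              grc_opt_mean n0 k L < grc_opt_mean n0 k M,
            grc_opt_prob n0 k L = expR (- 1) &
            grc_opt_mean n0 k L = expR 1 * L]) /\
      (* degenerate case: the optimum L = 0 is on the boundary *)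
      (k = 0%N \/ k = n0 ->
        [/\ L = 0,
            forall M : R, 0 < M -> expR 1 * L < grc_opt_mean n0 k M,
            grc_opt_mean n0 k M @[M --> L^'+] --> expR 1 * L &
            grc_opt_mean n0 k L = expR 1 * L])].
Proof.
split.
- move=> M n ch; split=> [d T P X gX|].
    apply: expectation_sum_geometric => // -[//|i] /andP[_ iM].
    exact: (grc_prob_itv ch).
  by apply: eq_bigr => i _; rewrite /grc_prob invf_div.
- by move=> M; exact: grc_opt_chain.
- move=> M n ch; have [le eq] := grc_mean_leif hk ch; split=> [min i|h n' ch'].
    case: i => // i /andP[_ iM].
    (* A chain strictly decreases from n0 to k, so it has no stage exactly when
       k = n0; this is the condition for an optimal chain to compare with. *)
    have M0 : (0 < M)%N = (k < n0)%N.
      apply/idP/idP => [M0|]; last first.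
        rewrite !ltnNge; apply: contra; rewrite leqn0 => /eqP M0.
        move: ch; rewrite M0 => -[-> /eqP]; rewrite eqr_nat => /eqP -> _.
        by rewrite leqnn.
      rewrite ltn_neqAle hk andbT; apply/eqP => n0k.
      have [n00 nM dec] := ch; have := dec 0%N M0.
      by rewrite ltNge n00 -n0k (grc_chain_ge ch).
    have [n' ch' opt] := grc_opt_chain (R := R) hk M0.
    have : grc_opt_mean n0 k M%:R == grc_mean k M n.
      rewrite eq_le le (le_trans (min n' ch'))// (ge_leif (grc_mean_leif hk ch')).
      by apply/forallP => j; apply/eqP/opt; exact: ltn_ord.
    by rewrite eq => /forallP /(_ (Ordinal iM)) /eqP.
  apply: (@le_trans _ _ (grc_opt_mean n0 k M%:R)); last by have [] := grc_mean_leif hk ch'.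
  rewrite (ge_leif (grc_mean_leif hk ch)); apply/forallP => i; apply/eqP/h; exact: ltn_ord.
- move=> M n ch h; apply/eqP; rewrite eq_sym (grc_mean_leif hk ch).
  by apply/forallP => i; apply/eqP/h; exact: ltn_ord.
- move=> L; have LE : L = ln 'C(n0, k)%:R by [].
  split=> [/andP[k0 kn0]|k0n].
    have L0 : 0 < L.
      rewrite ln_gt0// ltr1n (leq_trans _ (leq_bin2l k kn0))//.
      by rewrite binSn ltnS.
    have oL : grc_opt_mean n0 k L = expR 1 * L.
      by rewrite (grc_opt_meanE hk) -LE divff ?gt_eqF// mulrC.
    split => //; first by move=> M M0 ML; rewrite oL; exact: grc_opt_mean_gt.
    by rewrite (grc_opt_probE hk) -LE divff// gt_eqF.
  have L0 : L = 0 by rewrite LE; case: k0n => ->; rewrite ?bin0 ?binn ln1.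
  have oM : grc_opt_mean n0 k = id :> (R -> R).
    by apply/funext => M; rewrite (grc_opt_meanE hk) -LE L0 mul0r expR0 mulr1.
  split => //.
  + by move=> M M0; rewrite oM L0 mulr0.
  + by rewrite oM L0 mulr0; apply: cvg_at_right_filter; exact: cvg_id.
  + by rewrite oM L0 mulr0.
Qed.
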